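(* Let $n,m$ be even integers with $0\le m\le n$, let $w_H(x)=e^{-x^2}$ on $\mathbb{R}$ and let $\{h_l\}_{l\ge0}$ be the orthonormal Hermite polynomials in $L^2(\mathbb{R},w_H)$ (positive leading coefficients). Let $\lambda_{\frac n2+1}$ be the smallest zero of the orthonormal Laguerre polynomial $p^{(-1/2)}_{\frac n2+1}(x)$ and $\lambda^{m/2}_{\frac{n-m}2+1}$ the smallest zero of the associated Laguerre polynomial $p^{(-1/2)}_{\frac{n-m}2+1}(x,\frac m2)$. Then: (1) The minimizers of $\operatorname{var}_S$ over $\mathbb{S}_n$ are exactly $\mathcal{H}_n(x)=\kappa_1\sum_{l=0}^{n/2}p^{(-1/2)}_l(\lambda_{\frac n2+1})\,h_{2l}(x)$ with $\kappa_1\in\mathbb{C}$ chosen so that $\|\mathcal{H}_n\|=1$ (unique up to a unimodular scalar), and $\min_{P\in\mathbb{S}_n}\operatorname{var}_S(P)=\lambda_{\frac n2+1}$. (2) The minimizers of $\operatorname{var}_S$ over $\mathbb{S}^m_n$ are exactly $\mathcal{H}^m_n(x)=\kappa_2\sum_{l=m/2}^{n/2}p^{(-1/2)}_{l-\frac m2}(\lambda^{m/2}_{\frac{n-m}2+1},\tfrac m2)\,h_{2l}(x)$ with $\kappa_2\in\mathbb{C}$ chosen so that $\|\mathcal{H}^m_n\|=1$ (unique up to a unimodular scalar), and $\min_{P\in\mathbb{S}^m_n}\operatorname{var}_S(P)=\lambda^{m/2}_{\frac{n-m}2+1}$.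
   Context: Norm: $\|f\|^2=\int_{\mathbb{R}}|f|^2e^{-x^2}dx$. $\operatorname{var}_S(f)=\int_{\mathbb{R}}x^2|f(x)|^2e^{-x^2}dx$. $\Pi_n=\{\sum_{l=0}^nc_lh_l\}$, $\Pi^m_n=\{\sum_{l=m}^nc_lh_l\}$ ($c_l\in\mathbb{C}$), and $\mathbb{S}_n,\mathbb{S}^m_n$ are their norm-one elements. For $\alpha>-1$, $p^{(\alpha)}_l$ are the orthonormal Laguerre polynomials in $L^2([0,\infty),x^\alpha e^{-x})$ with positive leading coefficient; they satisfy $b_{l+1}p^{(\alpha)}_{l+1}(x)=(x-a_l)p^{(\alpha)}_l(x)-b_lp^{(\alpha)}_{l-1}(x)$ with $a_l=2l+\alpha+1$, $b_l=\sqrt{l(l+\alpha)}$ for $l\ge1$. The associated Laguerre polynomials are defined by $p^{(\alpha)}_{-1}(x,M)=0$, $p^{(\alpha)}_0(x,M)=1$, $b_{M+l+1}p^{(\alpha)}_{l+1}(x,M)=(x-a_{M+l})p^{(\alpha)}_l(x,M)-b_{M+l}p^{(\alpha)}_{l-1}(x,M)$, $l\ge0$. *)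

(* Defs.v *)
From HB Require Import structures.
From mathcomp Require Import all_boot all_order all_algebra.
From mathcomp Require Import all_classical all_reals all_analysis.
From mathcomp Require Import complex.
Set Implicit Arguments. Unset Strict Implicit. Unset Printing Implicit Defensive.
Import Order.TTheory GRing.Theory Num.Theory.
Local Open Scope ring_scope.
Local Open Scope complex_scope.

Section Defs.
Variable R : realType.

Definition sqmod (z : R[i]) : R := let: a +i* b := z in a ^+ 2 + b ^+ 2.

(* orthonormal Hermite polynomials in L^2(R, e^{-x^2}), positive leading
   coefficient, via the three-term recurrence
   x h_l = sqrt((l+1)/2) h_{l+1} + sqrt(l/2) h_{l-1},  h_0 = pi^{-1/4}. *)
Fixpoint hermite_pair (l : nat) (x : R) : R * R :=
  match l with
  | 0 => let h0 := (Num.sqrt (Num.sqrt pi))^-1 in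
         (h0, x * h0 / Num.sqrt (1 / 2))
  | l'.+1 => let: (u, v) := hermite_pair l' x in
         (v, (x * v - Num.sqrt (l'.+1%:R / 2) * u) / Num.sqrt (l'.+2%:R / 2))
  end.
Definition hermite (l : nat) (x : R) : R := (hermite_pair l x).1.

Definition lag_a (alpha : R) (l : nat) : R := 2 * l%:R + alpha + 1.
Definition lag_b (alpha : R) (l : nat) : R := Num.sqrt (l%:R * (l%:R + alpha)).

(* associated Laguerre polynomials p^{(alpha)}_l(x, M):
   p_{-1} = 0, p_0 = 1,
   b_{M+l+1} p_{l+1} = (x - a_{M+l}) p_l - b_{M+l} p_{l-1}. *)
Fixpoint assoc_lag_pair (alpha : R) (M l : nat) (x : R) : R * R :=
  match l with
  | 0 => (1, (x - lag_a alpha M) / lag_b alpha (M + 1))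
  | l'.+1 => let: (u, v) := assoc_lag_pair alpha M l' x in
      (v, ((x - lag_a alpha (M + l'.+1)) * v - lag_b alpha (M + l'.+1) * u)
            / lag_b alpha (M + l'.+2))
  end.
Definition assoc_laguerre (alpha : R) (M l : nat) (x : R) : R :=
  (assoc_lag_pair alpha M l x).1.

(* orthonormal Laguerre polynomials in L^2([0,oo), x^alpha e^{-x}):
   p_0 = (int_0^oo x^alpha e^{-x} dx)^{-1/2} and the recurrence above with M = 0 *)
Definition laguerre_p0 (alpha : R) : R :=
  (Num.sqrt (fine (\int[lebesgue_measure]_(x in `[0, +oo[%classic)
                    (x `^ alpha * expR (- x))%:E)))^-1.
Definition laguerre (alpha : R) (l : nat) (x : R) : R :=
  laguerre_p0 alpha * assoc_laguerre alpha 0 l x.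

Definition smallest_zero (f : R -> R) (lam : R) : Prop :=
  f lam = 0 /\ forall mu, f mu = 0 -> lam <= mu.

Definition sqnorm (f : R -> R[i]) : \bar R :=
  (\int[lebesgue_measure]_x (sqmod (f x) * expR (- x ^+ 2))%:E)%E.
Definition varS (f : R -> R[i]) : \bar R :=
  (\int[lebesgue_measure]_x (x ^+ 2 * sqmod (f x) * expR (- x ^+ 2))%:E)%E.

(* sum_{l=m}^{n} c_l h_l  (element of Pi^m_n; Pi_n is m = 0) *)
Definition hsum (m n : nat) (c : nat -> R[i]) (x : R) : R[i] :=
  \sum_(m <= l < n.+1) c l * (hermite l x)%:C.

End Defs.

(* Main.v *)
Require Import Defs.
From HB Require Import structures.
From mathcomp Require Import all_boot all_order all_algebra.
From mathcomp Require Import all_classical all_reals all_analysis.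
From mathcomp Require Import measurable_realfun complex ring lra zify.
Import Order.TTheory GRing.Theory Num.Theory.
Import numFieldNormedType.Exports.
Local Open Scope ring_scope.
Local Open Scope complex_scope.

(** In the orthonormal basis of Hermite polynomials, multiplication by [x^2]
    does not mix the even and odd indices, and on each parity it is a Jacobi
    matrix: the Laguerre one with [alpha = -1/2] on the [h_{2l}], and with
    [alpha = 1/2] on the [h_{2l+1}].

    If [lam] is the smallest zero of [p_{n+1}], the numbers
    [q_l = (-1)^l p_l(lam)], [l <= n], are positive, and the quadratic form of
    the Jacobi matrix minus [lam] is the sum of the squares
    [b_{l+1} q_l q_{l+1} (c_l / q_l + c_{l+1} / q_{l+1})^2].  Hence it is
    nonnegative and vanishes only on the multiples of [(p_l(lam))_l].

    The odd coefficients, one fewer than the even ones, cannot do better: a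
    Hardy-type inequality shows that the [alpha = 1/2] form dominates the
    [alpha = -1/2] form of the same vector padded by a final 0, and since
    [p_n(lam) <> 0] a nonzero padded vector is never a ground state. *)

(** * Jacobi forms *)

(** Take [y] minimal in the compact set of points of [[a, b]] where [f <= 0]. The intermediate value
    theorem puts a zero in [[a, y]]; it lies in that set, hence equals [y]. *)
Lemma first_zero (R : realType) (f : R -> R) (a b : R) :
  continuous f -> a <= b -> 0 < f a -> f b <= 0 ->
  exists y, [/\ a <= y <= b, f y = 0 & forall x, a <= x < y -> 0 < f x].
Proof.
move=> cf ab fa fb.
pose K := (`[a, b] `&` f @^-1` [set y | y <= 0])%classic.
have cK : compact K.
  apply: compact_closedI; first exact: segment_compact.
  by apply: preimage_closed => //; exact: closed_le.
have [||y] := @compact_EVT_min _ R id K _ cK.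
- by exists b; split => //=; rewrite in_itv/= ab lexx.
- by apply: continuous_subspaceT => x; exact: cvg_id.
rewrite inE /K /= in_itv/= => -[/andP[ay yb] fy] ymin.
exists y; split; first by rewrite ay.
- have [||c] := @IVT R f a y 0 ay.
  + by apply: continuous_subspaceT.
  + by rewrite ge_min fy orbT le_max (ltW fa).
  rewrite in_itv/= => /andP[ac cy] fc.
  have yc : y <= c.
    by apply: ymin; rewrite inE /K /= in_itv/= ac (le_trans cy yb) fc.
  by rewrite -fc; congr f; apply/le_anti; rewrite yc cy.
- move=> x /andP[ax xy]; rewrite ltNge; apply/negP => fx.
  suff : y <= x by rewrite leNgt xy.
  by apply: ymin; rewrite inE /K /= in_itv/= ax (le_trans (ltW xy) yb).
Qed.

Section JacobiForm.
Variable R : realType.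
Implicit Types (a b c : nat -> R) (p : nat -> R -> R).

Definition jacobi_form a b c (n : nat) : R :=
  \sum_(l < n) a l * c l ^+ 2 + 2 * \sum_(l < n.-1) b l.+1 * c l * c l.+1.

(** The recurrence is kept free of division; its first step stands apart because there is no
    [p_(-1)]. *)
Definition jacobi_rec a b p :=
  [/\ forall x, p 0%N x = 1,
      forall x, b 1%N * p 1%N x = x - a 0%N &
      forall l x, b l.+2 * p l.+2 x = (x - a l.+1) * p l.+1 x - b l.+1 * p l x].

Variables (a b : nat -> R) (p : nat -> R -> R).
Hypothesis pP : jacobi_rec a b p.
Hypothesis b_gt0 : forall l, 0 < b l.+1.

Let b_neq0 l : b l.+1 != 0. Proof. by rewrite gt_eqF. Qed.

(** Far to the left [p l] has the sign [(-1)^l]; the factor makes [q l] positive there. *)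
Let q l x := (- 1) ^+ l * p l x.

Let q0 x : q 0 x = 1. Proof. by case: pP => + _ _; rewrite /q mul1r => ->. Qed.

Let q1 x : b 1 * q 1 x = a 0 - x.
Proof.
by case: pP => _ + _; rewrite /q expr1 mulN1r mulrN => ->; rewrite opprB.
Qed.

Let q2 l x : b l.+2 * q l.+2 x = (a l.+1 - x) * q l.+1 x - b l.+1 * q l x.
Proof.
case: pP => _ _ H; rewrite /q mulrCA H 2!exprS; ring.
Qed.

Lemma jacobi_rec_continuous l : continuous (p l).
Proof.
case: pP => p0 p1 p2.
suff: continuous (p l) /\ continuous (p l.+1) by case.
elim: l => [|l [IH0 IH1]].
  split; first by rewrite (_ : p 0 = cst 1); [exact: cst_continuous|apply/funext].
  have -> : p 1%N = fun x => (b 1%N)^-1 * (x - a 0%N).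
    by apply/funext => x; rewrite -p1 mulrA mulVf ?mul1r.
  by move=> x; apply: cvgM; [exact: cvg_cst|apply: cvgB; [exact: cvg_id|exact: cvg_cst]].
split=> //.
have -> : p l.+2 = fun x => (b l.+2)^-1 * ((x - a l.+1) * p l.+1 x - b l.+1 * p l x).
  by apply/funext => x; rewrite -p2 mulrA mulVf ?mul1r.
move=> x; apply: cvgM; first exact: cvg_cst.
apply: cvgB; apply: cvgM => //; [|exact: IH1|exact: cvg_cst|exact: IH0].
by apply: cvgB; [exact: cvg_id|exact: cvg_cst].
Qed.

Let q_continuous l : continuous (q l).
Proof.
by move=> x; apply: cvgM; [exact: cvg_cst|exact: jacobi_rec_continuous].
Qed.

Variable x0 : R.
Hypothesis b0 : 0 <= b 0.
Hypothesis x0P : forall l, b l + b l.+1 <= a l - x0.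

(** Diagonal dominance [x0P] plays the part of Gershgorin's bound: left of [x0] it makes [q l x]
    nondecreasing in [l], starting from [q 0 x = 1]. *)
Let q_gt0_left l x : x <= x0 -> 0 < q l x.
Proof.
move=> xx0.
suff : 0 < q l x /\ q l x <= q l.+1 x by case.
elim: l => [|l [IH0 IH1]].
  rewrite q0; split => //; rewrite -(ler_pM2l (b_gt0 0)) q1 mulr1.
  have := x0P 0; have := b0; lra.
have q1_gt0 : 0 < q l.+1 x by apply: lt_le_trans IH1.
split=> //; rewrite -(ler_pM2l (b_gt0 l.+1)) q2.
have h := x0P l.+1; have b1 := b_gt0 l.
have h1 : b l.+1 * q l x <= b l.+1 * q l.+1 x by rewrite ler_pM2l.
have h2 : (b l.+1 + b l.+2) * q l.+1 x <= (a l.+1 - x) * q l.+1 x.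
  by rewrite ler_pM2r//; lra.
lra.
Qed.

(** Minimum of [q 0], ..., [q n.-1]; the initial 1 is the value of [q 0]. A first zero of this one
    continuous function is the first zero among all the [q l]. *)
Let qmin := fix qmin n x : R :=
  if n is k.+1 then Order.min (qmin k x) (q k x) else 1.

Let qmin_continuous n : continuous (qmin n).
Proof.
elim: n => [|n IH] x; first exact: cvg_cst.
by apply: continuous_min; [exact: IH|exact: q_continuous].
Qed.

Let qmin_gt0 n x : (forall l, (l < n)%N -> 0 < q l x) -> 0 < qmin n x.
Proof.
elim: n => [|n IH] h //=; rewrite lt_min h// IH// => l ln.
by apply: h; rewrite ltnS ltnW.
Qed.

Let qmin_le n x l : (l < n)%N -> qmin n x <= q l x.
Proof.
elim: n => [//|n IH] /=; rewrite ltnS leq_eqVlt ge_min => /orP[/eqP ->|/IH ->//].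
by rewrite lexx orbT.
Qed.

(** Two consecutive zeros propagate down the recurrence to [q 0 = 1]. *)
Let q_double_zero l x : q l x = 0 -> q l.+1 x = 0 -> False.
Proof.
elim: l => [|l IH] h0 h1; first by move: h0; rewrite q0 => /eqP; rewrite oner_eq0.
apply: IH => //; have := q2 l x; rewrite h1 h0 !mulr0 => /eqP.
by rewrite eq_sym subr_eq0 eq_sym mulf_eq0 (negbTE (b_neq0 _)) /= => /eqP.
Qed.

(* The first point where some [(-1)^l p_l], [l <= n + 1], vanishes can only be
   a zero of [p_(n+1)]: at a zero of a lower one its two neighbours have
   opposite signs, by the recurrence. *)
Lemma jacobi_rec_alternate n lam :
  smallest_zero (p n.+1) lam -> forall l, (l <= n)%N -> 0 < (- 1) ^+ l * p l lam.
Proof.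
move=> [plam lamP].
have qlam : q n.+1 lam = 0 by rewrite /q plam mulr0.
have x0lam : x0 <= lam.
  rewrite leNgt; apply/negP => /ltW /(q_gt0_left n.+1).
  by rewrite qlam ltxx.
have [||y [/andP[x0y ylam] ym yP]] := first_zero _ _ _ _ (qmin_continuous n.+2) x0lam.
- by apply: qmin_gt0 => l _; exact: q_gt0_left.
- by rewrite -qlam; exact: qmin_le.
have qy_ge0 l : (l < n.+2)%N -> 0 <= q l y by move=> /(qmin_le _ y); rewrite ym.
have qy l : (l <= n)%N -> 0 < q l y.
  move=> ln; rewrite lt_neqAle qy_ge0 ?andbT; last by rewrite ltnS leqW.
  apply/eqP => /esym ql0.
  case: l ln ql0 => [|l] ln ql0; first by move: ql0; rewrite q0 => /eqP; rewrite oner_eq0.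
  have h1 := qy_ge0 l.+2 ln.
  have h2 : 0 <= q l y by apply: qy_ge0; lia.
  have := q2 l y; rewrite ql0 mulr0 sub0r => h.
  have h3 : 0 <= b l.+2 * q l.+2 y by rewrite mulr_ge0// ltW.
  have h4 : 0 <= b l.+1 * q l y by rewrite mulr_ge0// ltW.
  have /eqP : b l.+1 * q l y = 0 by apply/le_anti; rewrite h4 andbT; lra.
  by rewrite mulf_eq0 (negbTE (b_neq0 _)) /= => /eqP qly; exact: (q_double_zero l y).
have qy0 : q n.+1 y = 0.
  apply/le_anti; rewrite qy_ge0// andbT leNgt; apply/negP => qn.
  suff : 0 < qmin n.+2 y by rewrite ym ltxx.
  apply: qmin_gt0 => l; rewrite ltnS leq_eqVlt => /orP[/eqP -> //|].
  exact: qy.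
have -> : lam = y.
  apply/le_anti; rewrite ylam andbT; apply: lamP.
  by move/eqP: qy0; rewrite /q mulf_eq0 signr_eq0 /= => /eqP.
exact: qy.
Qed.

(** Ground state substitution, valid at any [lam] where no [q l] with [l <= n] vanishes. The last
    term is the boundary term that lets the induction run; it disappears when [lam] is a zero of
    [p n.+1]. *)
Lemma jacobi_form_ground c n lam :
  (forall l, (l <= n)%N -> q l lam != 0) ->
  jacobi_form a b c n.+1 - lam * \sum_(l < n.+1) c l ^+ 2 =
  \sum_(l < n) b l.+1 * (c l * q l.+1 lam + c l.+1 * q l lam) ^+ 2
                / (q l lam * q l.+1 lam) + b n.+1 * q n.+1 lam / q n lam * c n ^+ 2.
Proof.
rewrite /jacobi_form /=; elim: n => [|n IH] qn.
  by rewrite !big_ord_recl !big_ord0 !addr0 !add0r mulr0 addr0 q1 q0 divr1; ring.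
have {}IH := IH (fun l ln => qn l (leqW ln)).
rewrite !(big_ord_recr n.+1) /= !(big_ord_recr n) /= in IH *.
have qn0 := qn n (leqnSn n); have qn1 := qn n.+1 (leqnn _).
rewrite [b n.+2 * _]q2.
set S4 := (\sum_(l < n) _ / _) in IH *.
set A := b n.+1 * q n.+1 lam / q n lam * c n ^+ 2 in IH.
(* The boundary term of the previous size is inserted so that the induction hypothesis can be used
   from right to left. *)
rewrite (_ : S4 = S4 + A - A); last by ring.
rewrite -IH /A; field; exact/andP.
Qed.

Section SmallestZero.
Variables (n : nat) (lam : R).
Hypothesis lamP : smallest_zero (p n.+1) lam.

Let q_gt0 l : (l <= n)%N -> 0 < q l lam.
Proof. exact: jacobi_rec_alternate. Qed.

Let ground c : jacobi_form a b c n.+1 - lam * \sum_(l < n.+1) c l ^+ 2 =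
  \sum_(l < n) b l.+1 * (c l * q l.+1 lam + c l.+1 * q l lam) ^+ 2
                / (q l lam * q l.+1 lam).
Proof.
rewrite jacobi_form_ground; last by move=> l ln; rewrite gt_eqF// q_gt0.
by case: lamP => pn _; rewrite [q n.+1 _]/q pn !(mulr0, mul0r) addr0.
Qed.

Let ground_ge0 c (l : 'I_n) :
  0 <= b l.+1 * (c l * q l.+1 lam + c l.+1 * q l lam) ^+ 2
         / (q l lam * q l.+1 lam).
Proof.
have ql := q_gt0 l (ltnW (ltn_ord l)); have ql1 := q_gt0 l.+1 (ltn_ord l).
apply: divr_ge0; first exact: mulr_ge0 (ltW (b_gt0 _)) (sqr_ge0 _).
exact: mulr_ge0 (ltW ql) (ltW ql1).
Qed.

Lemma jacobi_form_ge c :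
  lam * \sum_(l < n.+1) c l ^+ 2 <= jacobi_form a b c n.+1.
Proof. by rewrite -subr_ge0 ground; apply: sumr_ge0 => l _. Qed.

(** Equality forces every square to vanish, that is [c l * q l.+1 lam = - c l.+1 * q l lam]; as
    [q l lam] is nonzero, [c 0] then determines all entries up to [n]. *)
Lemma jacobi_form_eq c :
  jacobi_form a b c n.+1 = lam * \sum_(l < n.+1) c l ^+ 2 ->
  forall l, (l <= n)%N -> c l = c 0 * p l lam.
Proof.
move/eqP; rewrite -subr_eq0 ground => /eqP h.
have {}h (l : 'I_n) : c l * q l.+1 lam + c l.+1 * q l lam = 0.
  have ql := q_gt0 l (ltnW (ltn_ord l)); have ql1 := q_gt0 l.+1 (ltn_ord l).
  have t0 := psumr_eq0P (fun i _ => ground_ge0 c i) h.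
  have /eqP := t0 l isT.
  rewrite mulf_eq0 invr_eq0 (gt_eqF (mulr_gt0 ql ql1)) orbF.
  by rewrite mulf_eq0 (negbTE (b_neq0 _)) sqrf_eq0 => /eqP.
elim=> [|l IH] ln; first by case: pP => -> _ _; rewrite mulr1.
have := h (Ordinal ln) => /=; rewrite (IH (ltnW ln)) => h1.
have ql := q_gt0 l (ltnW ln).
apply: (mulIf (lt0r_neq0 ql)).
move/eqP: h1; rewrite addrC addr_eq0 => /eqP ->; rewrite /q exprS; ring.
Qed.

Lemma jacobi_form_eigen (k : R) :
  jacobi_form a b (fun l => k * p l lam) n.+1 =
  lam * \sum_(l < n.+1) (k * p l lam) ^+ 2.
Proof.
apply/eqP; rewrite -subr_eq0 ground big1// => l _.
rewrite (_ : _ + _ = 0) ?expr0n ?mulr0 ?mul0r//.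
rewrite /q exprS; ring.
Qed.

End SmallestZero.

Lemma jacobi_form_pad c n : c n = 0 ->
  jacobi_form a b c n.+1 = jacobi_form a b c n.
Proof.
case: n => [|n] cn; rewrite /jacobi_form /= big_ord_recr/= cn expr0n mulr0 addr0//.
by rewrite [\sum_(l < n.+1) b _ * _ * _]big_ord_recr/= cn mulr0 addr0.
Qed.

End JacobiForm.

(** * Comparison of the Laguerre forms for [alpha = -1/2] and [alpha = 1/2] *)

Section LaguerreForm.
Variable R : realType.
Implicit Types c : nat -> R.

Notation am := (lag_a (- (1 / 2) : R)).
Notation bm := (lag_b (- (1 / 2) : R)).
Notation ap := (lag_a (1 / 2 : R)).
Notation bp := (lag_b (1 / 2 : R)).

Lemma lag_b_sqr (alpha : R) l : - 1 <= alpha ->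
  lag_b alpha l.+1 ^+ 2 = l.+1%:R * (l.+1%:R + alpha).
Proof.
move=> h; rewrite /lag_b sqr_sqrtr// mulr_ge0// -natr1.
have : 0 <= l%:R :> R by []. lra.
Qed.

Lemma lag_b_gt0 (alpha : R) l : - 1 < alpha -> 0 < lag_b alpha l.+1.
Proof.
move=> h; rewrite /lag_b sqrtr_gt0 mulr_gt0// -natr1.
have : 0 <= l%:R :> R by []. lra.
Qed.

Lemma lag_bm_le l : bm l <= l%:R.
Proof.
case: l => [|l]; first by rewrite /lag_b mul0r sqrtr0.
rewrite -(@ler_pXn2r _ 2)// ?nnegrE ?sqrtr_ge0// lag_b_sqr; last by lra.
have : 0 <= l.+1%:R :> R by []. nra.
Qed.

Lemma assoc_laguerre_rec M : jacobi_rec R (fun l => am (M + l)%N)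
  (fun l => bm (M + l)%N) (assoc_laguerre (- (1 / 2)) M).
Proof.
have nz l : bm (M + l.+1)%N != 0 by rewrite addnS gt_eqF// lag_b_gt0//; lra.
split=> [//|x|l x].
  by rewrite /assoc_laguerre/= addn0 mulrC divfK.
rewrite /assoc_laguerre /=.
case: (assoc_lag_pair _ _ _ _) => u v /=; rewrite mulrC divfK//.
Qed.

(* The slack [s / (2s - 1)] and [s / (2s + 1)] are chosen so that the second
   one at [s] and the first one at [s + 1] add up to 1, the gap of the diagonals. *)
Lemma lag_b_gap_ge0 (s : nat) (x y : R) : (0 < s)%N ->
  0 <= s%:R / (2 * s%:R - 1) * x ^+ 2 + 2 * (bp s - bm s) * x * y
       + s%:R / (2 * s%:R + 1) * y ^+ 2.
Proof.
case: s => // s _.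
have hA := lag_b_sqr (1 / 2) s ltac:(lra).
have hB := lag_b_sqr (- (1 / 2)) s ltac:(lra).
have A0 : 0 < bp s.+1 by apply: lag_b_gt0; lra.
have B0 : 0 < bm s.+1 by apply: lag_b_gt0; lra.
set A := bp s.+1 in hA A0 *; set B := bm s.+1 in hB B0 *.
have : 1 <= s.+1%:R :> R by rewrite ler1n.
set t : R := s.+1%:R in hA hB * => t1.
clearbody A B t.
pose P := t / (2 * t - 1); pose Q := t / (2 * t + 1).
have P0 : 0 < P by apply: divr_gt0; lra.
(* Discriminant condition. Since [A^2 + B^2 = 2 t^2], it says that [A * B] is at least
   [t^2 - P * Q / 2], which is checked by squaring. *)
have hd : (A - B) ^+ 2 <= P * Q.
  have u3 : 0 < 4 * t ^+ 2 - 1 by nra.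
  have -> : P * Q = t ^+ 2 / (4 * t ^+ 2 - 1).
    by rewrite /P /Q; field; rewrite !gt_eqF//; lra.
  suff : t ^+ 2 - t ^+ 2 / (2 * (4 * t ^+ 2 - 1)) <= A * B.
    rewrite invfM; nra.
  rewrite -(@ler_pXn2r _ 2)// ?nnegrE; last by rewrite mulr_ge0// ltW.
    rewrite exprMn hA hB -subr_ge0.
    have -> : t * (t + 1 / 2) * (t * (t + - (1 / 2))) -
       (t ^+ 2 - t ^+ 2 / (2 * (4 * t ^+ 2 - 1))) ^+ 2 =
       t ^+ 2 * (3 * (4 * t ^+ 2 - 1) - 1) / (16 * (4 * t ^+ 2 - 1) ^+ 2).
      by field; rewrite gt_eqF.
    rewrite divr_ge0 ?mulr_ge0 ?sqr_ge0//; nra.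
  have -> : t ^+ 2 - t ^+ 2 / (2 * (4 * t ^+ 2 - 1)) =
     t ^+ 2 * (2 * (4 * t ^+ 2 - 1) - 1) / (2 * (4 * t ^+ 2 - 1)).
    by field; rewrite gt_eqF.
  rewrite divr_ge0 ?mulr_ge0 ?sqr_ge0//; nra.
(* Completing the square after multiplication by [P]. *)
suff : 0 <= P * (P * x ^+ 2 + 2 * (A - B) * x * y + Q * y ^+ 2).
  by rewrite pmulr_rge0.
have -> : P * (P * x ^+ 2 + 2 * (A - B) * x * y + Q * y ^+ 2) =
  (P * x + (A - B) * y) ^+ 2 + (P * Q - (A - B) ^+ 2) * y ^+ 2 by ring.
apply: addr_ge0; first exact: sqr_ge0.
by apply: mulr_ge0; [rewrite subr_ge0|exact: sqr_ge0].
Qed.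

(** The right side is the difference of the two Laguerre forms. The bound keeps a share of
    [c n ^+ 2] in reserve, which pays for the cross term with [c n.+1] in the next induction
    step. *)
Lemma laguerre_form_gap M c n :
  (M + n).+1%:R / (2 * (M + n).+1%:R - 1) * c n ^+ 2 <=
  jacobi_form R (fun=> 1) (fun l => bp (M + l)%N - bm (M + l)%N) c n.+1.
Proof.
rewrite /jacobi_form /=; elim: n => [|n IH].
  rewrite big_ord_recl !big_ord0 !addr0 mulr0 addr0 mul1r addn0.
  rewrite ler_piMl ?sqr_ge0// -natr1; have h : 0 <= M%:R :> R by [].
  by rewrite ler_pdivrMr; lra.
rewrite !(big_ord_recr n.+1) /= [X in _ <= _ + 2 * X]big_ord_recr /=.
have := lag_b_gap_ge0 (M + n).+1 (c n) (c n.+1) isT.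
rewrite [(M + n.+1)%N]addnS; set s := (M + n).+1 in IH * => h.
have -> : s.+1%:R / (2 * s.+1%:R - 1) = 1 - s%:R / (2 * s%:R + 1) :> R.
  have h0 : 0 <= s%:R :> R by [].
  by rewrite -natr1; move: (s%:R) h0 => t h0; field; rewrite !gt_eqF//; lra.
lra.
Qed.

Lemma laguerre_form_le M c n :
  jacobi_form R (fun l => am (M + l)%N) (fun l => bm (M + l)%N) c n <=
  jacobi_form R (fun l => ap (M + l)%N) (fun l => bp (M + l)%N) c n.
Proof.
case: n => [|n]; first by rewrite /jacobi_form !big_ord0.
rewrite -subr_ge0.
suff -> : jacobi_form R (fun l => ap (M + l)%N) (fun l => bp (M + l)%N) c n.+1
  - jacobi_form R (fun l => am (M + l)%N) (fun l => bm (M + l)%N) c n.+1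
  = jacobi_form R (fun=> 1) (fun l => bp (M + l)%N - bm (M + l)%N) c n.+1.
  apply: le_trans (laguerre_form_gap M c n).
  apply: mulr_ge0; last exact: sqr_ge0.
  by apply: divr_ge0 => //; rewrite -natr1; have : 0 <= (M + n)%:R :> R by []; lra.
rewrite /jacobi_form/= opprD addrACA -mulrBr -!sumrB; congr (_ + 2 * _).
  by apply: eq_bigr => l _; rewrite /lag_a; field.
by apply: eq_bigr => l _; ring.
Qed.

Lemma jacobi_form_ext (a b c c' : nat -> R) n :
  (forall l, (l < n)%N -> c l = c' l) -> jacobi_form R a b c n = jacobi_form R a b c' n.
Proof.
move=> cc'; congr (_ + 2 * _); apply: eq_bigr => l _; first by rewrite cc'.
by rewrite !cc'//; have := ltn_ord l; lia.
Qed.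

Section SmallestZero.
Variables (M n : nat) (lam : R).
Hypothesis lamP : smallest_zero (assoc_laguerre (- (1 / 2)) M n.+1) lam.

Notation form_m := (jacobi_form R (fun l => am (M + l)%N) (fun l => bm (M + l)%N)).
Notation form_p := (jacobi_form R (fun l => ap (M + l)%N) (fun l => bp (M + l)%N)).
Notation p := (assoc_laguerre (- (1 / 2) : R) M).

Let pP := assoc_laguerre_rec M.

Let b_gt0 l : 0 < bm (M + l.+1)%N.
Proof. by rewrite addnS lag_b_gt0//; lra. Qed.

Let b0 : 0 <= bm (M + 0)%N.
Proof. exact: sqrtr_ge0. Qed.

(** The point -1 is far enough left: by [lag_bm_le] the two off-diagonal entries at index
    [k = M + l] sum to at most [2k + 1], while the diagonal entry is [2k + 1/2]. *)
Let x0P l : bm (M + l)%N + bm (M + l.+1)%N <= am (M + l)%N - -1.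
Proof.
have := lag_bm_le (M + l); have := lag_bm_le (M + l.+1).
by rewrite addnS -[(M + l).+1%:R]natr1 /lag_a; lra.
Qed.

Lemma laguerre_form_ge c :
  lam * \sum_(l < n.+1) c l ^+ 2 <= form_m c n.+1.
Proof. exact: (jacobi_form_ge _ _ _ _ pP b_gt0 (-1) b0 x0P). Qed.

Lemma laguerre_form_eq c : form_m c n.+1 = lam * \sum_(l < n.+1) c l ^+ 2 ->
  forall l, (l <= n)%N -> c l = c 0%N * p l lam.
Proof. exact: (jacobi_form_eq _ _ _ _ pP b_gt0 (-1) b0 x0P). Qed.

Lemma laguerre_form_eigen (k : R) : form_m (fun l => k * p l lam) n.+1 =
  lam * \sum_(l < n.+1) (k * p l lam) ^+ 2.
Proof. exact: (jacobi_form_eigen _ _ _ _ pP b_gt0 (-1) b0 x0P). Qed.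

Let pad c := fun l => if (l < n)%N then c l else 0 : R.

Let sum_pad c : \sum_(l < n.+1) pad c l ^+ 2 = \sum_(l < n) c l ^+ 2.
Proof.
rewrite big_ord_recr/= /pad ltnn expr0n addr0.
by apply: eq_bigr => l _; rewrite ltn_ord.
Qed.

Let form_pad c : form_m (pad c) n.+1 <= form_p c n.
Proof.
rewrite jacobi_form_pad; last by rewrite /pad ltnn.
rewrite (jacobi_form_ext _ _ c (pad c)) => [|l ln]; last by rewrite /pad ln.
exact: laguerre_form_le.
Qed.

Lemma laguerre_odd_form_ge c : lam * \sum_(l < n) c l ^+ 2 <= form_p c n.
Proof. by rewrite -sum_pad; apply: le_trans (form_pad c); exact: laguerre_form_ge. Qed.

Lemma laguerre_odd_form_eq c : form_p c n = lam * \sum_(l < n) c l ^+ 2 ->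
  forall l, (l < n)%N -> c l = 0.
Proof.
move=> h; have {}h : form_m (pad c) n.+1 = lam * \sum_(l < n.+1) pad c l ^+ 2.
  by apply/le_anti; rewrite laguerre_form_ge andbT sum_pad -h form_pad.
have {}h := laguerre_form_eq _ h.
(* The padded vector is [pad c 0] times [(p l lam)]. Its entry at [n] is 0 while [p n lam] is
   nonzero by sign alternation, so the factor is 0. *)
have c0 : pad c 0%N = 0.
  have := h n (leqnn n); rewrite {1}/pad ltnn => /esym/eqP; rewrite mulf_eq0.
  have := jacobi_rec_alternate _ _ _ _ pP b_gt0 (-1) b0 x0P _ _ lamP n (leqnn n).
  by move=> /lt0r_neq0; rewrite mulf_eq0 negb_or => /andP[_ /negbTE ->]; rewrite orbF => /eqP.
move=> l ln; have := h l (ltnW ln); rewrite c0 mul0r /pad ln => ->//.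
Qed.

End SmallestZero.

End LaguerreForm.

(** * Gaussian integrals of polynomials *)

Section GaussFunctional.
Variable R : realType.
Implicit Types p q : {poly R}.
Local Open Scope classical_set_scope.
Local Open Scope ring_scope.
Local Notation mu := (@lebesgue_measure R).

(** The standard normal density up to a constant, hence integrable. Its square is the weight, so one
    factor can absorb polynomial growth while the other dominates. *)
Let half_gauss (x : R) := expR (- (x ^+ 2 / 2)).

Let half_gauss_integrable : mu.-integrable setT (EFin \o half_gauss).
Proof.
have := integrableZl measurableT (normal_peak (1 : R))^-1
  (@integrable_normal_pdf R 0 1).
apply: eq_integrable => // x _ /=.
rewrite normal_pdfE ?oner_neq0// -EFinM mulrA mulVf ?mul1r.
  by rewrite /normal_fun /half_gauss subr0 expr1n mulNr.
by rewrite gt_eqF// normal_peak_gt0 ?oner_neq0.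
Qed.

Let gauss_halfE x : gauss_fun x = half_gauss x * half_gauss x :> R.
Proof. by rewrite /gauss_fun /half_gauss -expRD; congr expR; field. Qed.

(** With [e = exp(x^2/2)], the exponential series gives [x^(2k+2) <= 2^(k+1) (k+1)! e]. This covers
    [|x| > 1]; for [|x| <= 1] the bound [1 <= e] is enough. *)
Let monomial_gauss_bound k (x : R) :
  `|x| ^+ k * gauss_fun x <= (2 ^+ k.+1 * k.+1`!%:R + 1) * half_gauss x.
Proof.
rewrite gauss_halfE mulrA ler_wpM2r ?expR_ge0//.
rewrite -ler_pdivlMr ?expR_gt0// /half_gauss expRN invrK.
set e := expR _.
have x2 : 0 <= x ^+ 2 / 2 by rewrite divr_ge0 ?sqr_ge0.
have h := expR_ge1Dxn k x2; rewrite -/e in h.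
have e1 : 1 <= e by rewrite -expR0 ler_expR.
have f0 : 0 < (k.+1)`!%:R :> R by rewrite ltr0n fact_gt0.
have h2 : (x ^+ 2) ^+ k.+1 <= 2 ^+ k.+1 * k.+1`!%:R * e.
  have -> : (x ^+ 2) ^+ k.+1 = 2 ^+ k.+1 * (x ^+ 2 / 2) ^+ k.+1.
    by rewrite -exprMn; congr (_ ^+ _); field.
  rewrite -mulrA ler_wpM2l ?exprn_ge0// -ler_pdivrMl// [_^-1 * _]mulrC.
  by apply: le_trans h; rewrite lerDr.
rewrite mulrDl mul1r.
have [x1|x1] := leP `|x| 1.
  apply: le_trans (exprn_ile1 _ _ x1) _ => //.
  rewrite (le_trans e1)// lerDr; apply: le_trans h2.
  by rewrite exprn_ge0 ?sqr_ge0.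
apply: le_trans (_ : (x ^+ 2) ^+ k.+1 <= _); last first.
  by rewrite (le_trans h2)// lerDl (le_trans ler01 e1).
rewrite -real_normK ?num_real// -exprM ler_weXn2l ?(ltW x1)//; lia.
Qed.

Lemma poly_gauss_bound p :
  exists2 C : R, 0 <= C & forall x, `|p.[x] * gauss_fun x| <= C * half_gauss x.
Proof.
exists (\sum_(i < size p) `|p`_i| * (2 ^+ i.+1 * i.+1`!%:R + 1)).
  by apply: sumr_ge0 => i _; rewrite mulr_ge0 ?addr_ge0 ?mulr_ge0 ?exprn_ge0.
move=> x; rewrite horner_coef normrM (ger0_norm (gauss_fun_ge0 x)).
apply: le_trans (ler_wpM2r (gauss_fun_ge0 x) (ler_norm_sum _ _ _)) _.
rewrite !mulr_suml; apply: ler_sum => i _.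
by rewrite normrM normrX -!mulrA ler_wpM2l.
Qed.

Let poly_gauss_continuous p : continuous (fun x => p.[x] * gauss_fun x).
Proof.
move=> x; apply: cvgM; last exact: continuous_gauss_fun.
exact/differentiable_continuous/derivable1_diffP/derivable_horner.
Qed.

Lemma poly_gauss_integrable p :
  mu.-integrable setT (fun x => (p.[x] * gauss_fun x)%:E).
Proof.
have [C C0 Cp] := poly_gauss_bound p.
apply: (le_integrable _ _ _ (integrableZl measurableT C half_gauss_integrable)) => //.
  apply/measurable_EFinP; apply: continuous_measurable_fun.
  exact: poly_gauss_continuous.
move=> x _ /=; rewrite lee_fin (le_trans (Cp x))//; exact: ler_norm.
Qed.

Definition gauss_int p : R := (\int[mu]_x (p.[x] * gauss_fun x))%R.

Lemma integral_poly_gauss p :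
  (\int[mu]_x (p.[x] * gauss_fun x)%:E)%E = (gauss_int p)%:E.
Proof.
by rewrite /gauss_int /Rintegral fineK// integrable_fin_num// poly_gauss_integrable.
Qed.

Lemma gauss_int_is_linear : scalar gauss_int.
Proof.
move=> k p q; rewrite /gauss_int -RintegralZl//; last exact: poly_gauss_integrable.
rewrite -RintegralD//; last exact: poly_gauss_integrable.
  by apply: eq_Rintegral => x _; rewrite hornerD hornerZ mulrDl mulrA.
have := integrableZl measurableT k (poly_gauss_integrable p).
by apply: eq_integrable => // x _.
Qed.

HB.instance Definition _ :=
  GRing.isLinear.Build R {poly R} R *%R gauss_int gauss_int_is_linear.

Lemma gauss_intD p q : gauss_int (p + q) = gauss_int p + gauss_int q.
Proof. exact: raddfD. Qed.

Lemma gauss_intZ (k : R) p : gauss_int (k *: p) = k * gauss_int p.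
Proof. exact: linearZ. Qed.

Lemma gauss_int_const (c : R) : gauss_int c%:P = c * Num.sqrt pi.
Proof.
rewrite /gauss_int; under eq_Rintegral do rewrite hornerC.
rewrite RintegralZl//; last exact: integrableT_gauss.
by rewrite /Rintegral integralT_gauss.
Qed.

(** The polynomial factor of the derivative of [p * exp(-x^2)]. *)
Let dgauss p : {poly R} := p^`() - 2 *: ('X * p).

Let is_derive_poly_gauss p (x : R) :
  is_derive x 1 (fun x => p.[x] * gauss_fun x) ((dgauss p).[x] * gauss_fun x).
Proof.
rewrite /gauss_fun; apply: is_derive_eq.
rewrite /= /dgauss !(hornerD, hornerN, hornerZ, hornerM, hornerX) /GRing.scale /=.
ring.
Qed.

Let integral_dgauss_itv p (n : nat) : (0 < n)%N ->
  (\int[mu]_(x in `[(- n%:R)%R, n%:R]) ((dgauss p).[x] * gauss_fun x)%:E =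
   (p.[n%:R] * gauss_fun n%:R)%:E - (p.[- n%:R] * gauss_fun (- n%:R))%:E)%E.
Proof.
move=> n0; apply: (@continuous_FTC2 _ _ (fun x => p.[x] * gauss_fun x)).
- by rewrite gtrN ?ltr0n.
- by apply: continuous_subspaceT; exact: poly_gauss_continuous.
- split=> [x _||].
  + by case: (is_derive_poly_gauss p x).
  + by apply: cvg_at_right_filter; exact: poly_gauss_continuous.
  + by apply: cvg_at_left_filter; exact: poly_gauss_continuous.
- by move=> x _; rewrite derive1E; case: (is_derive_poly_gauss p x).
Qed.

Let poly_gauss_cvg0 p (s : R) : `|s| = 1 ->
  p.[s * n%:R] * gauss_fun (s * n%:R) @[n --> \oo] --> (0 : R).
Proof.
move=> s1; have [C C0 Cp] := poly_gauss_bound p.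
apply/norm_cvg0P.
apply: (@squeeze_cvgr _ _ _ _ (cst 0) (fun n : nat => C * (2 * harmonic n))).
(* The bound [exp(-n^2/2) <= 2 / (n + 1)] follows from [1 + y <= exp y] and [n^2 - n + 1 >= 0]. *)
- near=> n; rewrite normr_ge0 /= (le_trans (Cp _))// ler_wpM2l//.
  rewrite /half_gauss expRN exprMn -[s ^+ 2]real_normK ?num_real// s1 expr1n mul1r.
  rewrite /harmonic /= ler_pdivlMr// ler_pdivrMl ?expR_gt0//.
  have := expR_ge1Dx (n%:R ^+ 2 / 2 : R); have := sqr_ge0 (n%:R - 1 / 2 : R).
  rewrite -[n.+1%:R]natr1; lra.
- exact: cvg_cst.
- rewrite -[X in _ --> X](mulr0 C) -[X in C * X](mulr0 2).
  apply: cvgM; first exact: cvg_cst.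
  by apply: cvgM; [exact: cvg_cst|exact: cvg_harmonic].
Unshelve. all: by end_near. Qed.

(** The integral of the derivative of [p * exp(-x^2)] is 0: it is the limit of the integrals over
    [[-n, n]] by dominated convergence, and these are boundary values tending to 0. *)
Lemma gauss_int_by_parts p : gauss_int p^`() = gauss_int (2 *: ('X * p)).
Proof.
apply/eqP; rewrite -subr_eq0 -raddfB/= -/(dgauss p).
pose f := fun x => ((dgauss p).[x] * gauss_fun x)%:E.
pose f_ (n : nat) := f \_ `[(- n%:R)%R, n%:R].
have intf : mu.-integrable setT f := poly_gauss_integrable _.
have mf : measurable_fun setT f by exact: measurable_int intf.
have [|||||_ _] := @dominated_convergence _ _ R mu setT measurableT f_ f (abse \o f).
- move=> n; apply: (@measurable_int _ _ _ mu).
  by rewrite /f_ -integrable_mkcond//; apply: integrableS intf.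
- by [].
- apply: aeW => x _; apply: cvg_near_cst; near=> n.
  rewrite /f_ patchE mem_set//= in_itv/= -ler_norml.
  by near: n; exact: nbhs_infty_ger.
- exact: integrable_abse.
- apply: aeW => x n _ /=; rewrite /f_ patchE; case: ifP => //.
  by rewrite abse0.
move=> h.
have h0 : [sequence (\int[mu]_x f_ n x)%E]_n @ \oo --> (0%:E : \bar R).
  have h1 : (p.[n%:R] * gauss_fun n%:R - p.[- n%:R] * gauss_fun (- n%:R) : R)
      @[n --> \oo] --> (0 : R).
    rewrite -[X in _ --> X](subr0 0); apply: cvgB.
      by have := poly_gauss_cvg0 p 1 (normr1 _); under eq_fun do rewrite mul1r.
    by have := poly_gauss_cvg0 p (-1) (normrN1 _); under eq_fun do rewrite mulN1r.
  apply: cvg_trans (cvg_comp _ _ h1 (cvg_id : EFin x @[x --> 0] --> 0%:E)).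
  apply: near_eq_cvg; near=> n.
  rewrite /f_ /= -integral_mkcond integral_dgauss_itv//.
  by near: n; exact: nbhs_infty_gt.
have : (\int[mu]_x f x)%E = 0%:E by exact: cvg_unique h h0.
by rewrite /f integral_poly_gauss => h2; apply/eqP; case: h2.
Unshelve. all: by end_near. Qed.

End GaussFunctional.

(** * Hermite polynomials *)

Section Hermite.
Variable R : realType.

Notation be k := (Num.sqrt (k%:R / 2) : R).

Let be_sqr k : be k ^+ 2 = k%:R / 2.
Proof. by rewrite sqr_sqrtr// divr_ge0. Qed.

Let be_neq0 k : be k.+1 != 0.
Proof. by rewrite gt_eqF// sqrtr_gt0 divr_gt0. Qed.

Let be0 : be 0 = 0.
Proof. by rewrite mul0r sqrtr0. Qed.

(** The same recurrence as [hermite_pair], run in the polynomial ring so that formal derivatives and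
    [gauss_int] apply. *)
Fixpoint hermite_poly (l : nat) : {poly R} :=
  if l isn't l1.+1 then ((Num.sqrt (Num.sqrt pi))^-1)%:P
  else if l1 isn't l2.+1 then (be 1)^-1 *: ('X * hermite_poly l1)
  else (be l)^-1 *: ('X * hermite_poly l1 - be l1 *: hermite_poly l2).

Local Notation H := hermite_poly.

Lemma hermite_polyE l x : hermite l x = (H l).[x].
Proof.
suff : hermite_pair l x = ((H l).[x], (H l.+1).[x]) by rewrite /hermite => ->.
elim: l => [|l IH].
  by rewrite /= !(hornerC, hornerZ, hornerM, hornerX) mulrC.
rewrite /= in IH *; rewrite IH; congr pair.
by rewrite !(hornerZ, hornerD, hornerN, hornerM, hornerX) mulrC.
Qed.

(* At [l = 0] the junk term [H l.-1] has coefficient [be 0 = 0]. *)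
Lemma hermite_poly_mulX l : 'X * H l = be l.+1 *: H l.+1 + be l *: H l.-1.
Proof.
case: l => [|l]; first by rewrite be0 scale0r addr0 [H 1]/= scalerA divff ?scale1r.
by rewrite [H l.+2]/= scalerA divff ?scale1r// subrK.
Qed.

(** Differentiating the recurrence, with two consecutive indices carried along; the coefficients
    match because [1 + 2 (be l.+1)^2 = 2 (be l.+2)^2]. *)
Lemma deriv_hermite_poly l : (H l)^`() = (2 * be l) *: H l.-1.
Proof.
suff : (H l)^`() = (2 * be l) *: H l.-1 /\ (H l.+1)^`() = (2 * be l.+1) *: H l.
  by case.
elim: l => [|l [IH0 IH1]].
  split; first by rewrite derivC be0 mulr0 scale0r.
  rewrite [H 1]/= derivZ derivM derivX derivC mulr0 addr0 mul1r; congr (_ *: _).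
  apply: (mulfI (be_neq0 0)); by rewrite divff// mulrCA -expr2 be_sqr; field.
split=> //.
apply: (scalerI (be_neq0 l.+1)).
have -> : be l.+2 *: (H l.+2)^`() = ('X * H l.+1 - be l.+1 *: H l)^`().
  by rewrite -derivZ [H l.+2]/= scalerA divff ?scale1r.
rewrite derivB derivM derivX derivZ mul1r IH0 IH1 -scalerAr hermite_poly_mulX.
rewrite scalerDr !scalerA.
have -> : be l.+1 * (2 * be l) = 2 * be l.+1 * be l by ring.
rewrite addrA addrK -{1}[H l.+1]scale1r -scalerDl; congr (_ *: _).
have := be_sqr l.+1; have := be_sqr l.+2; rewrite -[l.+2%:R]natr1; lra.
Qed.

(** Integration by parts of [H k * q]: the term with the derivative of [H k] cancels the lowering
    part of ['X * H k], so raising is adjoint to differentiation. *)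
Lemma gauss_int_hermite_raise k q :
  be k.+1 * gauss_int R (H k.+1 * q) = gauss_int R (H k * q^`()) / 2.
Proof.
have e : 2 *: ('X * (H k * q)) =
    (2 * be k.+1) *: (H k.+1 * q) + (2 * be k) *: (H k.-1 * q).
  by rewrite mulrA hermite_poly_mulX mulrDl scalerDr -!scalerAl !scalerA.
have := gauss_int_by_parts R (H k * q).
rewrite e derivM deriv_hermite_poly -scalerAl !gauss_intD !gauss_intZ; lra.
Qed.

(** Raising lowers both indices by one, until one factor is the constant [H 0], whose derivative
    vanishes. *)
Lemma hermite_orthonormal k l : gauss_int R (H k * H l) = (k == l)%:R.
Proof.
have z k' : gauss_int R (H k'.+1 * H 0) = 0.
  apply: (mulfI (be_neq0 k')).
  by rewrite gauss_int_hermite_raise derivC mulr0 raddf0 mul0r mulr0.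
elim: k l => [|k IH] [|l].
- rewrite -polyCM gauss_int_const -invfM -expr2 sqr_sqrtr ?sqrtr_ge0//.
  by rewrite mulVf// gt_eqF// sqrtr_gt0 pi_gt0.
- by rewrite mulrC z.
- by rewrite z.
apply: (mulfI (be_neq0 k)).
rewrite gauss_int_hermite_raise deriv_hermite_poly /= -scalerAr gauss_intZ IH eqSS.
by case: eqVneq => [->|_] /=; field.
Qed.

(** One factor ['X] goes to each Hermite polynomial. Predecessors at index 0 are harmless since
    their coefficient is [be 0 = 0]. *)
Lemma gauss_int_X2_hermite k l : gauss_int R ('X^2 * (H k * H l)) =
  be k.+1 * be l.+1 * (k == l)%:R + be k * be l.+1 * (k.-1 == l.+1)%:R
  + be k.+1 * be l * (k.+1 == l.-1)%:R + be k * be l * (k.-1 == l.-1)%:R.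
Proof.
have -> : 'X^2 * (H k * H l) = ('X * H k) * ('X * H l) by ring.
rewrite !hermite_poly_mulX mulrDl !mulrDr -![in LHS]scalerAl -![in LHS]scalerAr.
rewrite !gauss_intD !gauss_intZ !hermite_orthonormal eqSS; ring.
Qed.

(** A tridiagonal Gram matrix yields a Jacobi form: each new [u n] meets only its predecessor. It
    serves for [w = 1] (norm) and [w = 'X^2] (variance). *)
Lemma gauss_int_tridiag (w : {poly R}) (u : nat -> {poly R}) (a b c : nat -> R) n :
  (forall i, gauss_int R (w * (u i * u i)) = a i) ->
  (forall i, gauss_int R (w * (u i * u i.+1)) = b i.+1) ->
  (forall i j, (i.+1 < j)%N -> gauss_int R (w * (u i * u j)) = 0) ->
  gauss_int R (w * (\sum_(i < n) c i *: u i) ^+ 2) = jacobi_form R a b c n.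
Proof.
move=> ha hb h0; rewrite /jacobi_form; elim: n => [|n IH].
  by rewrite !big_ord0 expr0n mulr0 raddf0 mulr0 addr0.
rewrite !(big_ord_recr n) /=; set S := \sum_(i < n) _ in IH *.
have -> : w * (S + c n *: u n) ^+ 2 = w * S ^+ 2 + c n *: (w * (S * u n))
    + c n *: (w * (S * u n)) + c n *: (c n *: (w * (u n * u n))).
  by rewrite -!mul_polyC; ring.
rewrite !gauss_intD !gauss_intZ ha IH.
have -> : gauss_int R (w * (S * u n)) =
    \sum_(i < n) c i * gauss_int R (w * (u i * u n)).
  rewrite mulr_suml mulr_sumr raddf_sum; apply: eq_bigr => i _.
  by rewrite -gauss_intZ -!mul_polyC; congr gauss_int; ring.
case: n S IH => [|n] S IH; first by rewrite /= !big_ord0; ring.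
have -> : \sum_(i < n.+1) c i * gauss_int R (w * (u i * u n.+1)) = c n * b n.+1.
  rewrite big_ord_recr /= hb big1 ?add0r// => i _.
  by rewrite h0 ?mulr0// ltnS.
rewrite /= [\sum_(l < n.+1) b _ * _ * _]big_ord_recr /=; ring.
Qed.

Lemma gauss_int_X2_diag k : gauss_int R ('X^2 * (H k * H k)) = k%:R + 1 / 2.
Proof.
rewrite gauss_int_X2_hermite !eqxx.
have -> : (k.-1 == k.+1) = false by lia.
have -> : (k.+1 == k.-1) = false by lia.
by rewrite !mulr0 !addr0 !mulr1 -!expr2 !be_sqr -natr1; field.
Qed.

Lemma gauss_int_X2_next k :
  gauss_int R ('X^2 * (H k * H k.+2)) = Num.sqrt (k.+1%:R / 2 * (k.+2%:R / 2)).
Proof.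
rewrite gauss_int_X2_hermite eqxx.
have -> : (k == k.+2) = false by lia.
have -> : (k.-1 == k.+3) = false by lia.
have -> : (k.-1 == k.+2.-1) = false by lia.
by rewrite !mulr0 !add0r addr0 mulr1 [RHS]sqrtrM ?divr_ge0.
Qed.

Lemma gauss_int_X2_far k l : (k.+2 < l)%N -> gauss_int R ('X^2 * (H k * H l)) = 0.
Proof.
move=> kl; rewrite gauss_int_X2_hermite.
have -> : (k == l) = false by lia.
have -> : (k.-1 == l.+1) = false by lia.
have -> : (k.+1 == l.-1) = false by lia.
have -> : (k.-1 == l.-1) = false by lia.
by rewrite !mulr0 !addr0.
Qed.

Lemma gauss_int_X2_parity k l : odd (k + l) -> gauss_int R ('X^2 * (H k * H l)) = 0.
Proof.
move=> kl; rewrite gauss_int_X2_hermite.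
have -> : (k == l) = false by lia.
have e1 : be k * be l.+1 * (k.-1 == l.+1)%:R = 0.
  case: k kl => [|k] kl; first by rewrite be0 !mul0r.
  by rewrite (_ : (_ == _) = false) ?mulr0//; lia.
have e2 : be k.+1 * be l * (k.+1 == l.-1)%:R = 0.
  case: l kl {e1} => [|l] kl; first by rewrite be0 !(mulr0, mul0r).
  by rewrite (_ : (_ == _) = false) ?mulr0//; lia.
(* Truncation breaks parity at 0, where [0.-1 = 1.-1]; the factor [be 0] kills that term. *)
have e3 : be k * be l * (k.-1 == l.-1)%:R = 0.
  case: k kl {e1 e2} => [|k] kl; first by rewrite be0 !mul0r.
  case: l kl => [|l] kl; first by rewrite be0 !(mulr0, mul0r).
  by rewrite (_ : (_ == _) = false) ?mulr0//; lia.
by rewrite e1 e2 e3 mulr0 !addr0.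
Qed.

(** Both end indices are even, so the odd block has one term fewer. *)
Lemma sum_even_odd (V : nmodType) (F : nat -> V) M N :
  \sum_(M.*2 <= l < (M + N).*2.+1) F l =
  \sum_(i < N.+1) F (M + i).*2 + \sum_(i < N) F (M + i).*2.+1.
Proof.
elim: N => [|N IH]; first by rewrite addn0 big_nat1 big_ord1 big_ord0 addn0 addr0.
have -> : (M + N.+1).*2.+1 = (M + N).*2.+3 by lia.
rewrite big_nat_recr /=; last by lia.
rewrite big_nat_recr /=; last by lia.
rewrite IH (big_ord_recr N.+1) [\sum_(i < N.+1) F (M + i).*2.+1]big_ord_recr /=.
by rewrite -!addrA; congr (_ + _); rewrite addnS doubleS addrA addrC.
Qed.

Section Blocks.
Variables (M N : nat) (r : nat -> R).

Let P := \sum_(M.*2 <= l < (M + N).*2.+1) r l *: H l.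
Let e i := r (M + i).*2.
Let o i := r (M + i).*2.+1.
Let E := \sum_(i < N.+1) e i *: H (M + i).*2.
Let O := \sum_(i < N) o i *: H (M + i).*2.+1.

Let gauss_int_split w :
  (forall i j, gauss_int R (w * (H (M + i).*2 * H (M + j).*2.+1)) = 0) ->
  gauss_int R (w * P ^+ 2) = gauss_int R (w * E ^+ 2) + gauss_int R (w * O ^+ 2).
Proof.
move=> h; have -> : P = E + O by rewrite /P sum_even_odd.
have -> : w * (E + O) ^+ 2 = w * E ^+ 2 + w * O ^+ 2 + w * (E * O) + w * (E * O) by ring.
rewrite !gauss_intD; have -> : gauss_int R (w * (E * O)) = 0; last by rewrite !addr0.
rewrite /E mulr_suml mulr_sumr raddf_sum big1// => i _.
rewrite /O !mulr_sumr raddf_sum big1// => j _.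
rewrite -[RHS](mulr0 (e i * o j)) -(h i j) -gauss_intZ; congr gauss_int.
by rewrite -!mul_polyC polyCM; ring.
Qed.

Lemma gauss_int_block_norm : gauss_int R (P ^+ 2) =
  \sum_(i < N.+1) e i ^+ 2 + \sum_(i < N) o i ^+ 2.
Proof.
(* The norm is read as the Jacobi form of the identity matrix. *)
have form1 n c : jacobi_form R (fun=> 1) (fun=> 0) c n = \sum_(i < n) c i ^+ 2.
  rewrite /jacobi_form [X in 2 * X]big1 => [|l _]; last by rewrite !mul0r.
  by rewrite mulr0 addr0; apply: eq_bigr => l _; rewrite mul1r.
rewrite -[P ^+ 2]mul1r gauss_int_split => [|i j]; last first.
  by rewrite mul1r hermite_orthonormal (_ : (_ == _) = false)//; lia.
rewrite -!form1; congr (_ + _).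
  apply: (gauss_int_tridiag 1 (fun i => H (M + i).*2)) => i *;
    rewrite mul1r hermite_orthonormal ?eqxx// (_ : (_ == _) = false)//; lia.
apply: (gauss_int_tridiag 1 (fun i => H (M + i).*2.+1)) => i *;
  rewrite mul1r hermite_orthonormal ?eqxx// (_ : (_ == _) = false)//; lia.
Qed.

(** At [k = 2i] and [k = 2i + 1] the diagonal [k + 1/2] is [2i + 1/2] and [2i + 3/2]; the squared
    off-diagonals [(k+1)(k+2)/4] are [(i+1)(i+1/2)] and [(i+1)(i+3/2)]. These are the Laguerre
    entries for [alpha = -1/2] and [alpha = 1/2]. *)
Lemma gauss_int_block_X2 : gauss_int R ('X^2 * P ^+ 2) =
  jacobi_form R (fun l => lag_a (- (1 / 2)) (M + l)%N)
                (fun l => lag_b (- (1 / 2)) (M + l)%N) e N.+1 +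
  jacobi_form R (fun l => lag_a (1 / 2) (M + l)%N)
                (fun l => lag_b (1 / 2) (M + l)%N) o N.
Proof.
rewrite gauss_int_split => [|i j]; last by apply: gauss_int_X2_parity; lia.
congr (_ + _).
  apply: (gauss_int_tridiag 'X^2 (fun i => H (M + i).*2)) => [i|i|i j ij].
  - by rewrite gauss_int_X2_diag /lag_a -muln2 natrM; field.
  - rewrite addnS doubleS gauss_int_X2_next /lag_b; congr Num.sqrt.
    by rewrite -muln2 -!natr1 natrM; field.
  - by apply: gauss_int_X2_far; lia.
apply: (gauss_int_tridiag 'X^2 (fun i => H (M + i).*2.+1)) => [i|i|i j ij].
- by rewrite gauss_int_X2_diag /lag_a -natr1 -muln2 natrM; field.
- rewrite addnS doubleS gauss_int_X2_next /lag_b; congr Num.sqrt.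
  by rewrite -muln2 -!natr1 natrM; field.
- by apply: gauss_int_X2_far; lia.
Qed.

End Blocks.

End Hermite.

(** * Complex coefficients and the minimizers of the variance *)

Section Minimizers.
Variable R : realType.
Implicit Types c : nat -> R[i].

Let re c l : R := complex.Re (c l).
Let im c l : R := complex.Im (c l).

(** The Hermite polynomials are real, so the complex problem splits into two real ones. *)
Lemma sqmod_hsum m n c x : sqmod (hsum m n c x) =
  ((\sum_(m <= l < n.+1) re c l *: hermite_poly R l) ^+ 2 +
   (\sum_(m <= l < n.+1) im c l *: hermite_poly R l) ^+ 2).[x].
Proof.
suff -> : hsum m n c x =
    (\sum_(m <= l < n.+1) re c l *: hermite_poly R l).[x] +i*
    (\sum_(m <= l < n.+1) im c l *: hermite_poly R l).[x].
  by rewrite hornerD !horner_exp.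
rewrite /hsum; elim/big_rec3: _ => [|l u v w _ ->]; first by rewrite !horner0.
rewrite !hornerD !hornerZ hermite_polyE /re /im.
by case: (c l) => a b; simpc.
Qed.

Variables M N : nat.

Let ev (r : nat -> R) i := r (M + i).*2.
Let od (r : nat -> R) i := r (M + i).*2.+1.
Let normR r : R := \sum_(i < N.+1) ev r i ^+ 2 + \sum_(i < N) od r i ^+ 2.
Let form_m (r : nat -> R) := jacobi_form R (fun l => lag_a (- (1 / 2)) (M + l)%N)
  (fun l => lag_b (- (1 / 2)) (M + l)%N) (ev r) N.+1.
Let form_p (r : nat -> R) := jacobi_form R (fun l => lag_a (1 / 2) (M + l)%N)
  (fun l => lag_b (1 / 2) (M + l)%N) (od r) N.
Let hs c := hsum M.*2 (M + N).*2 c.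

Lemma sqnorm_hsum c : sqnorm (hs c) = (normR (re c) + normR (im c))%:E.
Proof.
have E r : normR r = _ := esym (gauss_int_block_norm R M N r).
rewrite !E -gauss_intD -integral_poly_gauss /sqnorm.
by apply: eq_integral => x _; rewrite sqmod_hsum.
Qed.

Lemma varS_hsum c :
  varS (hs c) = (form_m (re c) + form_p (re c) + (form_m (im c) + form_p (im c)))%:E.
Proof.
have E r : form_m r + form_p r = _ := esym (gauss_int_block_X2 R M N r).
rewrite !E -gauss_intD -integral_poly_gauss /varS.
apply: eq_integral => x _; rewrite sqmod_hsum -mulrDr.
by rewrite hornerM hornerXn.
Qed.

Variable lam : R.
Hypothesis lamP : smallest_zero (assoc_laguerre (- (1 / 2)) M N.+1) lam.
Notation p l := (assoc_laguerre (- (1 / 2) : R) M l lam).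

Let form_ge r : lam * normR r <= form_m r + form_p r.
Proof.
by rewrite mulrDr lerD// ?(laguerre_form_ge _ _ _ _ lamP)//
  (laguerre_odd_form_ge _ _ _ _ lamP).
Qed.

Let form_eq r : form_m r + form_p r = lam * normR r ->
  (forall i, (i <= N)%N -> ev r i = ev r 0 * p i) /\
  (forall i, (i < N)%N -> od r i = 0).
Proof.
move=> h.
have h1 := laguerre_form_ge _ _ _ _ lamP (ev r).
have h2 := laguerre_odd_form_ge _ _ _ _ lamP (od r).
rewrite -/(form_m r) -/(form_p r) in h1 h2.
rewrite /normR mulrDr in h.
split; first by apply: (laguerre_form_eq _ _ _ _ lamP); rewrite -/(form_m r); lra.
by apply: (laguerre_odd_form_eq _ _ _ _ lamP); rewrite -/(form_p r); lra.
Qed.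

(** Coefficients of the candidate minimizer with factor [k], supported on even indices. *)
Let ground (k : R[i]) l : R[i] :=
  if odd l then 0 else k * (p (l./2 - M))%:C.

Let re_ground k : (ev (re (ground k)) = fun i => complex.Re k * p i) /\
  (od (re (ground k)) = fun=> 0).
Proof.
split; apply/funext => i; rewrite /ev /od /re /ground /= odd_double//=.
by rewrite doubleK addKn; case: k => a b; simpc.
Qed.

Let im_ground k : (ev (im (ground k)) = fun i => complex.Im k * p i) /\
  (od (im (ground k)) = fun=> 0).
Proof.
split; apply/funext => i; rewrite /ev /od /im /ground /= odd_double//=.
by rewrite doubleK addKn; case: k => a b; simpc.
Qed.

Let hsum_ground k x : hs (ground k) x = k * \sum_(M <= l < (M + N).+1)
  (p (l - M))%:C * (hermite l.*2 x)%:C.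
Proof.
rewrite /hs /hsum sum_even_odd [X in _ + X]big1 => [|i _]; last first.
  by rewrite /ground /= odd_double mul0r.
rewrite addr0 -[X in \sum_(X <= _ < _) _]add0n big_addn -addnS addKn big_mkord mulr_sumr.
apply: eq_bigr => i _; rewrite /ground odd_double doubleK addKn mulrA.
by rewrite addnK [(i + M)%N]addnC.
Qed.

Let form_ground r k : ev r = (fun i => k * p i) -> od r = (fun=> 0) ->
  form_m r + form_p r = lam * normR r.
Proof.
move=> er or; rewrite /form_m /form_p /normR er or.
rewrite (laguerre_form_eigen _ _ _ _ lamP) /jacobi_form.
rewrite [X in _ + (X + _)]big1; last by move=> i _; rewrite expr0n mulr0.
rewrite [X in _ + (_ + 2 * X)]big1; last by move=> i _; rewrite mulr0.
rewrite [X in lam * (_ + X)]big1; last by move=> i _; rewrite expr0n.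
by rewrite mulr0 !addr0.
Qed.

Let varS_ground k : varS (hs (ground k)) = (lam%:E * sqnorm (hs (ground k)))%E.
Proof.
have [r1 r2] := re_ground k; have [i1 i2] := im_ground k.
by rewrite varS_hsum sqnorm_hsum (form_ground _ _ r1 r2) (form_ground _ _ i1 i2) -mulrDr.
Qed.

Lemma hermite_minimizers :
  (forall c, sqnorm (hs c) = 1%E -> (lam%:E <= varS (hs c))%E) /\
  (forall c, sqnorm (hs c) = 1%E ->
     (varS (hs c) = lam%:E <->
      exists kappa : R[i], forall x : R,
        hs c x = kappa * \sum_(M <= l < (M + N).+1)
          (p (l - M))%:C * (hermite l.*2 x)%:C)) /\
  (exists c, sqnorm (hs c) = 1%E /\ varS (hs c) = lam%:E).
Proof.
split; [|split].
- move=> c; rewrite sqnorm_hsum varS_hsum lee_fin => -[h].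
  by rewrite -[lam]mulr1 -h mulrDr lerD.
- move=> c hc; split; last first.
    (* Norm and variance depend on [c] only through the function [hs c]. *)
    move=> [k hk]; have e : hs c = hs (ground k).
      by apply/funext => x; rewrite hk hsum_ground.
    by rewrite e varS_ground -e hc mule1.
  move: hc; rewrite sqnorm_hsum varS_hsum => -[h] [h'].
  have hr := form_ge (re c); have hi := form_ge (im c).
  have e1 : lam * (normR (re c) + normR (im c)) = lam by rewrite h mulr1.
  rewrite mulrDr in e1.
  (* The two lower bounds add up to an equality, so each of them is one. *)
  have [er odr] : (forall i, (i <= N)%N -> ev (re c) i = ev (re c) 0 * p i) /\
      (forall i, (i < N)%N -> od (re c) i = 0) by apply: form_eq; lra.
  have [ei odi] : (forall i, (i <= N)%N -> ev (im c) i = ev (im c) 0 * p i) /\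
      (forall i, (i < N)%N -> od (im c) i = 0) by apply: form_eq; lra.
  (* The factor is the lowest coefficient, since [p 0 = 1]; its real and imaginary parts are the
     factors of the two real problems. *)
  exists (c M.*2) => x; rewrite -hsum_ground /hs /hsum !sum_even_odd.
  congr (_ + _); apply: eq_bigr => i _; congr (_ * _); rewrite /ground /= odd_double /=.
    rewrite doubleK addKn.
    have := er i (ltn_ord i : (i <= N)%N); have := ei i (ltn_ord i : (i <= N)%N).
    rewrite /ev /re /im !addn0; case: (c _.*2) => a b; case: (c _.*2) => a' b' /=.
    by move=> -> ->; simpc.
  have := odr i (ltn_ord i); have := odi i (ltn_ord i).
  by rewrite /od /re /im; case: (c _.*2.+1) => a b /= -> ->.
(* Normalizing constant, positive because the term of [p 0 = 1] alone contributes 1. *)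
pose s : R := \sum_(i < N.+1) p i ^+ 2.
have s1 : 0 < s.
  rewrite /s big_ord_recl; apply: ltr_pwDl; first by rewrite expr1n.
  by apply: sumr_ge0 => i _; exact: sqr_ge0.
pose k := (Num.sqrt s)^-1.
have hn : sqnorm (hs (ground k%:C)) = 1%E.
  have [r1 r2] := re_ground k%:C; have [i1 i2] := im_ground k%:C.
  rewrite sqnorm_hsum /normR r1 r2 i1 i2 /=; congr EFin.
  rewrite [X in _ + X + _]big1; last by move=> i _; rewrite expr0n.
  rewrite [X in _ + (X + _)]big1; last by move=> i _; rewrite mul0r expr0n.
  rewrite [X in _ + (_ + X)]big1; last by move=> i _; rewrite expr0n.
  rewrite !addr0; under eq_bigr do rewrite exprMn.
  by rewrite -mulr_sumr -/s exprVn sqr_sqrtr ?(ltW s1)// mulVf// gt_eqF.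
by exists (ground k%:C); split => //; rewrite varS_ground hn mule1.
Qed.

End Minimizers.

(** * Minimization over [S_n] and [S^m_n] *)

Theorem theorem5p2 (R : realType) (n m : nat) :
  ~~ odd n -> ~~ odd m -> (m <= n)%N ->
  (* (1) minimization over S_n *)
  (forall lam : R,
     smallest_zero (laguerre (- (1 / 2)) (n./2).+1) lam ->
     (forall c : nat -> R[i], sqnorm (hsum 0 n c) = 1%E ->
        (lam%:E <= varS (hsum 0 n c))%E) /\
     (forall c : nat -> R[i], sqnorm (hsum 0 n c) = 1%E ->
        (varS (hsum 0 n c) = lam%:E <->
         exists kappa : R[i], forall x : R,
           hsum 0 n c x = kappa * \sum_(0 <= l < (n./2).+1)
              (laguerre (- (1 / 2)) l lam)%:C * (hermite l.*2 x)%:C)) /\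
     (exists c : nat -> R[i],
        sqnorm (hsum 0 n c) = 1%E /\ varS (hsum 0 n c) = lam%:E)) /\
  (* (2) minimization over S^m_n *)
  (forall lam : R,
     smallest_zero (assoc_laguerre (- (1 / 2)) m./2 ((n - m)./2).+1) lam ->
     (forall c : nat -> R[i], sqnorm (hsum m n c) = 1%E ->
        (lam%:E <= varS (hsum m n c))%E) /\
     (forall c : nat -> R[i], sqnorm (hsum m n c) = 1%E ->
        (varS (hsum m n c) = lam%:E <->
         exists kappa : R[i], forall x : R,
           hsum m n c x = kappa * \sum_(m./2 <= l < (n./2).+1)
              (assoc_laguerre (- (1 / 2)) m./2 (l - m./2) lam)%:C
                * (hermite l.*2 x)%:C)) /\
     (exists c : nat -> R[i],
        sqnorm (hsum m n c) = 1%E /\ varS (hsum m n c) = lam%:E)).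
Proof.
move=> on om mn.
have [M mE] : exists M, m = M.*2 by exists m./2; rewrite even_halfK.
have [N nE] : exists N, n = (M + N).*2.
  by exists (n./2 - M)%N; move: on om mn; rewrite mE; lia.
subst n m; rewrite !doubleK {on om mn}.
have -> : ((M + N).*2 - M.*2)./2 = N by lia.
split=> lam; last exact: hermite_minimizers.
set g := laguerre_p0 (- (1 / 2) : R) => -[lam0 lamP].
(* If the normalisation [g] were 0, every real would be a zero. *)
have g0 : g != 0.
  apply/eqP => g0; suff : lam <= lam - 1 by lra.
  by apply: lamP; rewrite /laguerre -/g g0 mul0r.
have zP : smallest_zero (assoc_laguerre (- (1 / 2)) 0 (M + N).+1) lam.
  split=> [|mu hmu]; last by apply: lamP; rewrite /laguerre hmu mulr0.
  by move/eqP: lam0; rewrite /laguerre -/g mulf_eq0 (negbTE g0) => /eqP.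
(* The first statement is the case of shift 0; the normalization [g] leaves the zeros unchanged and
   is absorbed into [kappa]. *)
have [h1 [h2 h3]] := hermite_minimizers R 0 (M + N) lam zP.
have sumE x : \sum_(0 <= l < (M + N).+1)
    (laguerre (- (1 / 2)) l lam)%:C * (hermite l.*2 x)%:C = g%:C *
   \sum_(0 <= l < (M + N).+1)
    (assoc_laguerre (- (1 / 2)) 0 (l - 0) lam)%:C * (hermite l.*2 x)%:C.
  rewrite mulr_sumr; apply: eq_bigr => l _.
  by rewrite subn0 /laguerre -/g rmorphM/= mulrA.
split=> //; split=> // c hc; rewrite (h2 c hc); split=> -[k hk].
  exists (k / g%:C) => x; rewrite hk sumE mulrA divfK//.
  by rewrite fmorph_eq0.
by exists (k * g%:C) => x; rewrite hk sumE mulrA.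
Qed.
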